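(* Let $\mathcal{L}_{\mathrm{DLE}}=\mathcal{L}_{\mathrm{DLE}}(\mathcal{F},\mathcal{G})$ be any DLE-language, let $\mathbf{L}_{\mathbb{DLE}}$ be the minimal $\mathcal{L}_{\mathrm{DLE}}$-logic and let $\mathbf{L}^*_{\mathbb{DLE}}$ be the minimal $\mathcal{L}^*_{\mathrm{DLE}}$-logic in the expanded language $\mathcal{L}^*_{\mathrm{DLE}}=\mathcal{L}_{\mathrm{DLE}}(\mathcal{F}^*,\mathcal{G}^* )$. Then $\mathbf{L}^*_{\mathbb{DLE}}$ is a conservative extension of $\mathbf{L}_{\mathbb{DLE}}$: for every $\mathcal{L}_{\mathrm{DLE}}$-sequent $\phi\vdash\psi$, $\phi\vdash\psi$ is derivable in $\mathbf{L}_{\mathbb{DLE}}$ if and only if $\phi\vdash\psi$ is derivable in $\mathbf{L}^*_{\mathbb{DLE}}$.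
   Context: An order-type over $n\in\mathbb{N}$ is a tuple $\varepsilon\in\{1,\partial\}^n$; $\varepsilon^\partial$ is the opposite order-type (with $1$ and $\partial$ exchanged in every coordinate). Language. A DLE-language $\mathcal{L}_{\mathrm{DLE}}(\mathcal{F},\mathcal{G})$ has a denumerable set of propositional variables and disjoint finite sets $\mathcal{F},\mathcal{G}$ of connectives; each $f\in\mathcal{F}$ has an arity $n_f\in\mathbb{N}$ and an order-type $\varepsilon_f$ over $n_f$, each $g\in\mathcal{G}$ an arity $n_g$ and an order-type $\varepsilon_g$ over $n_g$. Formulas: $\phi::=p\mid\bot\mid\top\mid\phi\wedge\phi\mid\phi\vee\phi\mid f(\overline{\phi})\mid g(\overline{\phi})$. A sequent is an expression $\phi\vdash\psi$ with $\phi,\psi$ formulas. For a connective $h$, $h_i[\phi]$ denotes $h$ with $\phi$ in the $i$-th coordinate and arbitrary parameters in the other coordinates (the same parameters throughout one axiom or rule). Minimal logic. $\mathbf{L}_{\mathbb{DLE}}$ is the smallest set of sequents containing the axioms $p\vdash p$, $\bot\vdash p$, $p\vdash\top$, $p\wedge(q\vee r)\vdash(p\wedge q)\vee(p\wedge r)$, $p\vdash p\vee q$, $q\vdash p\vee q$, $p\wedge q\vdash p$, $p\wedge q\vdash q$; for $f\in\mathcal{F}$: $f_i[\bot]\vdash\bot$ and $f_i[p\vee q]\vdash f_i[p]\vee f_i[q]$ if $\varepsilon_f(i)=1$, and $f_i[\top]\vdash\bot$ and $f_i[p\wedge q]\vdash f_i[p]\vee f_i[q]$ if $\varepsilon_f(i)=\partial$;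 for $g\in\mathcal{G}$: $\top\vdash g_j[\top]$ and $g_j[p]\wedge g_j[q]\vdash g_j[p\wedge q]$ if $\varepsilon_g(j)=1$, and $\top\vdash g_j[\bot]$ and $g_j[p]\wedge g_j[q]\vdash g_j[p\vee q]$ if $\varepsilon_g(j)=\partial$; and closed under: from $\phi\vdash\chi$ and $\chi\vdash\psi$ infer $\phi\vdash\psi$; uniform substitution; from $\chi\vdash\phi$ and $\chi\vdash\psi$ infer $\chi\vdash\phi\wedge\psi$; from $\phi\vdash\chi$ and $\psi\vdash\chi$ infer $\phi\vee\psi\vdash\chi$; and for every $h\in\mathcal{F}\cup\mathcal{G}$, from $\phi\vdash\psi$ infer $h_i[\phi]\vdash h_i[\psi]$ if $\varepsilon_h(i)=1$, and infer $h_i[\psi]\vdash h_i[\phi]$ if $\varepsilon_h(i)=\partial$. Expanded language. $\mathcal{F}^*\supseteq\mathcal{F}$ and $\mathcal{G}^*\supseteq\mathcal{G}$ are obtained by adding: binary connectives $\to_H,\leftarrow_H\in\mathcal{G}^*$ (order-types $(\partial,1)$ and $(1,\partial)$) and binary connectives $\succ,\prec\,\in\mathcal{F}^*$ (order-types $(1,\partial)$ and $(\partial,1)$); for each $f\in\mathcal{F}$ and $1\le i\le n_f$ an $n_f$-ary connective $f_i^\sharp$, which is in $\mathcal{G}^*$ if $\varepsilon_f(i)=1$ and in $\mathcal{F}^*$ if $\varepsilon_f(i)=\partial$; for each $g\in\mathcal{G}$ and $1\le j\le n_g$ an $n_g$-ary connective $g_j^\flat$, which is in $\mathcal{F}^*$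 if $\varepsilon_g(j)=1$ and in $\mathcal{G}^*$ if $\varepsilon_g(j)=\partial$. The order-types are those forced by the intended interpretation as residuals/Galois-adjoints: for $h^\bullet_i\in\{f_i^\sharp,g_i^\flat\}$ obtained from $h$, if $\varepsilon_h(i)=1$ the order-type is $1$ at $i$ and $\varepsilon_h^\partial(j)$ at $j\neq i$; if $\varepsilon_h(i)=\partial$ it is $\partial$ at $i$ and $\varepsilon_h(j)$ at $j\ne i$. $\mathbf{L}^*_{\mathbb{DLE}}$ is the smallest set of sequents of the language $\mathcal{L}_{\mathrm{DLE}}(\mathcal{F}^*,\mathcal{G}^* )$ containing the axioms $p\vdash p$, $\bot\vdash p$, $p\vdash\top$, $p\wedge(q\vee r)\vdash(p\wedge q)\vee(p\wedge r)$, $p\vdash p\vee q$, $q\vdash p\vee q$, $p\wedge q\vdash p$, $p\wedge q\vdash q$; for $f\in\mathcal{F}^*$: $f_i[\bot]\vdash\bot$ and $f_i[p\vee q]\vdash f_i[p]\vee f_i[q]$ if $\varepsilon_f(i)=1$, and $f_i[\top]\vdash\bot$ and $f_i[p\wedge q]\vdash f_i[p]\vee f_i[q]$ if $\varepsilon_f(i)=\partial$; for $g\in\mathcal{G}^*$: $\top\vdash g_j[\top]$ and $g_j[p]\wedge g_j[q]\vdash g_j[p\wedge q]$ if $\varepsilon_g(j)=1$, and $\top\vdash g_j[\bot]$ and $g_j[p]\wedge g_j[q]\vdash g_j[p\vee q]$ if $\varepsilon_g(j)=\partial$; closed under: from $\phi\vdash\chi$ and $\chi\vdash\psi$ infer $\phi\vdash\psi$;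 uniform substitution; from $\chi\vdash\phi$ and $\chi\vdash\psi$ infer $\chi\vdash\phi\wedge\psi$; from $\phi\vdash\chi$ and $\psi\vdash\chi$ infer $\phi\vee\psi\vdash\chi$; for every $h\in\mathcal{F}^*\cup\mathcal{G}^*$, from $\phi\vdash\psi$ infer $h_i[\phi]\vdash h_i[\psi]$ if $\varepsilon_h(i)=1$, and infer $h_i[\psi]\vdash h_i[\phi]$ if $\varepsilon_h(i)=\partial$; and additionally closed under the following rules in both directions: $\phi\wedge\psi\vdash\chi$ iff $\psi\vdash\phi\to_H\chi$; $\phi\wedge\psi\vdash\chi$ iff $\phi\vdash\chi\leftarrow_H\psi$; $\phi\vdash\psi\vee\chi$ iff $\psi\prec\phi\vdash\chi$; $\phi\vdash\psi\vee\chi$ iff $\phi\succ\chi\vdash\psi$; for $f\in\mathcal{F}$: $f_i[\phi]\vdash\psi$ iff $\phi\vdash f_i^\sharp[\psi]$ when $\varepsilon_f(i)=1$, and $f_i[\phi]\vdash\psi$ iff $f_i^\sharp[\psi]\vdash\phi$ when $\varepsilon_f(i)=\partial$; for $g\in\mathcal{G}$: $\phi\vdash g_j[\psi]$ iff $g_j^\flat[\phi]\vdash\psi$ when $\varepsilon_g(j)=1$, and $\phi\vdash g_j[\psi]$ iff $\psi\vdash g_j^\flat[\phi]$ when $\varepsilon_g(j)=\partial$ (same parameters on both sides). *)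

(* Defs.v *)
From HB Require Import structures.
From mathcomp Require Import all_boot.

Set Implicit Arguments.
Unset Strict Implicit.
Unset Printing Implicit Defensive.

(* A DLE-language. The disjoint finite families F and G are given as one finite
   type of connectives split by [isF]: F = {h | isF h} and G = {h | ~~ isF h}.
   Order-types are boolean-valued: [true] encodes 1 and [false] encodes the
   dual sign. Coordinates are numbered from 0. *)
Record dle_sig := DleSig {
  conn :> finType;
  isF : pred conn;
  arity : conn -> nat;
  otype : forall h : conn, 'I_(arity h) -> bool
}.

Arguments isF {d} h.
Arguments arity {d} h.
Arguments otype {d} h i.

Inductive form (S : dle_sig) : Type :=
| Var of nat
| Bot
| Top
| And of form S & form S
| Or of form S & form S
| App (h : conn S) (args : {ffun 'I_(arity h) -> form S}).

Arguments Var {S} _.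
Arguments Bot {S}.
Arguments Top {S}.
Arguments App {S} h args.

Definition sequent (S : dle_sig) : Type := (form S * form S)%type.

Declare Scope dle_scope.
Delimit Scope dle_scope with dle.
Bind Scope dle_scope with form.
Bind Scope dle_scope with sequent.
Local Open Scope dle_scope.
Notation "phi ∧ psi" := (And phi psi) (at level 80, right associativity) : dle_scope.
Notation "phi ∨ psi" := (Or phi psi) (at level 85, right associativity) : dle_scope.
Notation "phi ⊢ psi" := (@pair (form _) (form _) phi psi)
  (at level 90, no associativity) : dle_scope.

(* h_i[phi] with parameters [a]; the entry [a i] is ignored. *)
Definition plug (S : dle_sig) (h : conn S) (i : 'I_(arity h))
    (a : {ffun 'I_(arity h) -> form S}) (phi : form S) : form S :=
  App h [ffun j => if j == i then phi else a j].

Arguments plug {S} h i a phi.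

Fixpoint subst (S : dle_sig) (s : nat -> form S) (phi : form S) : form S :=
  match phi with
  | Var p => s p
  | Bot => Bot
  | Top => Top
  | And phi1 phi2 => subst s phi1 ∧ subst s phi2
  | Or phi1 phi2 => subst s phi1 ∨ subst s phi2
  | App h a => App h [ffun i => subst s (a i)]
  end.

(* The smallest set of sequents containing the axioms of the minimal logic and
   closed under its rules and, in both directions, under the additional
   invertible one-premise rules [R]. *)
Inductive derivable (S : dle_sig) (R : sequent S -> sequent S -> Prop) :
    sequent S -> Prop :=
| ax_id (p : nat) : derivable R (Var p ⊢ Var p)
| ax_bot (p : nat) : derivable R (Bot ⊢ Var p)
| ax_top (p : nat) : derivable R (Var p ⊢ Top)
| ax_distr (p q r : nat) :
    derivable R (Var p ∧ (Var q ∨ Var r) ⊢ (Var p ∧ Var q) ∨ (Var p ∧ Var r))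
| ax_orl (p q : nat) : derivable R (Var p ⊢ Var p ∨ Var q)
| ax_orr (p q : nat) : derivable R (Var q ⊢ Var p ∨ Var q)
| ax_andl (p q : nat) : derivable R (Var p ∧ Var q ⊢ Var p)
| ax_andr (p q : nat) : derivable R (Var p ∧ Var q ⊢ Var q)
| ax_F_bot f i a : isF f -> otype f i = true ->
    derivable R (plug f i a Bot ⊢ Bot)
| ax_F_or f i a (p q : nat) : isF f -> otype f i = true ->
    derivable R (plug f i a (Var p ∨ Var q)
                 ⊢ plug f i a (Var p) ∨ plug f i a (Var q))
| ax_F_top f i a : isF f -> otype f i = false ->
    derivable R (plug f i a Top ⊢ Bot)
| ax_F_and f i a (p q : nat) : isF f -> otype f i = false ->
    derivable R (plug f i a (Var p ∧ Var q)
                 ⊢ plug f i a (Var p) ∨ plug f i a (Var q))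
| ax_G_top g j a : ~~ isF g -> otype g j = true ->
    derivable R (Top ⊢ plug g j a Top)
| ax_G_and g j a (p q : nat) : ~~ isF g -> otype g j = true ->
    derivable R (plug g j a (Var p) ∧ plug g j a (Var q)
                 ⊢ plug g j a (Var p ∧ Var q))
| ax_G_bot g j a : ~~ isF g -> otype g j = false ->
    derivable R (Top ⊢ plug g j a Bot)
| ax_G_or g j a (p q : nat) : ~~ isF g -> otype g j = false ->
    derivable R (plug g j a (Var p) ∧ plug g j a (Var q)
                 ⊢ plug g j a (Var p ∨ Var q))
| rule_cut phi chi psi :
    derivable R (phi ⊢ chi) -> derivable R (chi ⊢ psi) ->
    derivable R (phi ⊢ psi)
| rule_subst s phi psi :
    derivable R (phi ⊢ psi) -> derivable R (subst s phi ⊢ subst s psi)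
| rule_and chi phi psi :
    derivable R (chi ⊢ phi) -> derivable R (chi ⊢ psi) ->
    derivable R (chi ⊢ phi ∧ psi)
| rule_or phi psi chi :
    derivable R (phi ⊢ chi) -> derivable R (psi ⊢ chi) ->
    derivable R (phi ∨ psi ⊢ chi)
| rule_mono h i a phi psi : otype h i = true ->
    derivable R (phi ⊢ psi) -> derivable R (plug h i a phi ⊢ plug h i a psi)
| rule_anti h i a phi psi : otype h i = false ->
    derivable R (phi ⊢ psi) -> derivable R (plug h i a psi ⊢ plug h i a phi)
| rule_extra s t : R s t -> derivable R s -> derivable R t
| rule_extra_inv s t : R s t -> derivable R t -> derivable R s.

Definition L_DLE (S : dle_sig) : sequent S -> Prop :=
  derivable (fun _ _ => False).

Inductive lat_res := ImpH | PmiH | Succ | Prec.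

Definition lat_res_code (l : lat_res) : bool * bool :=
  match l with
  | ImpH => (false, false)
  | PmiH => (false, true)
  | Succ => (true, false)
  | Prec => (true, true)
  end.

Definition lat_res_decode (c : bool * bool) : lat_res :=
  match c with
  | (false, false) => ImpH
  | (false, true) => PmiH
  | (true, false) => Succ
  | (true, true) => Prec
  end.

Lemma lat_res_codeK : cancel lat_res_code lat_res_decode.
Proof. by case. Qed.

HB.instance Definition _ := Finite.copy lat_res (can_type lat_res_codeK).

(* [Adj h i] is the residual or Galois-adjoint of [h] in coordinate [i]: the
   sharp connective if [h] is in F, the flat one if [h] is in G. *)
Inductive star_conn (S : dle_sig) :=
| Old of conn S
| Lat of lat_res
| Adj (h : conn S) of 'I_(arity h).

Arguments Lat {S} _.

Section StarConnFinite.
Variable S : dle_sig.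

Let code_type := (conn S + lat_res + {h : conn S & 'I_(arity h)})%type.

Definition star_conn_code (c : star_conn S) : code_type :=
  match c with
  | Old h => inl (inl h)
  | Lat l => inl (inr l)
  | Adj h i => inr (existT _ h i)
  end.

Definition star_conn_decode (c : code_type) : star_conn S :=
  match c with
  | inl (inl h) => Old h
  | inl (inr l) => Lat l
  | inr (existT h i) => Adj i
  end.

Lemma star_conn_codeK : cancel star_conn_code star_conn_decode.
Proof. by case. Qed.

HB.instance Definition _ := Finite.copy (star_conn S) (can_type star_conn_codeK).

End StarConnFinite.

Definition star_isF (S : dle_sig) (c : star_conn S) : bool :=
  match c with
  | Old h => isF h
  | Lat ImpH | Lat PmiH => false
  | Lat Succ | Lat Prec => true
  | Adj h i => if otype h i then ~~ isF h else isF h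
  end.

Definition star_arity (S : dle_sig) (c : star_conn S) : nat :=
  match c with
  | Old h => arity h
  | Lat _ => 2
  | Adj h _ => arity h
  end.

(* The order-type of ImpH and Prec is (dual, 1); that of PmiH and Succ is
   (1, dual). *)
Definition star_otype (S : dle_sig) (c : star_conn S) :
    'I_(star_arity c) -> bool :=
  match c return 'I_(star_arity c) -> bool with
  | Old h => fun j => otype h j
  | Lat ImpH | Lat Prec => fun j => j == 1 :> nat
  | Lat PmiH | Lat Succ => fun j => j == 0 :> nat
  | Adj h i => fun j =>
      if j == i then otype h i
      else if otype h i then ~~ otype h j else otype h j
  end.

Definition star_sig (S : dle_sig) : dle_sig :=
  @DleSig (star_conn S) (@star_isF S) (@star_arity S) (@star_otype S).

Definition old (S : dle_sig) (h : conn S) : conn (star_sig S) := Old h.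

Definition lat (S : dle_sig) (l : lat_res) : conn (star_sig S) :=
  Lat l : star_conn S.

Definition adj (S : dle_sig) (h : conn S) (i : 'I_(arity h)) :
  conn (star_sig S) := Adj i.

Arguments lat S l : clear implicits.
Arguments adj {S} h i.

Definition bin (S : dle_sig) (l : lat_res) (phi psi : form (star_sig S)) :
    form (star_sig S) :=
  App (lat S l) [ffun i : 'I_2 => if i == 0 :> nat then phi else psi].

Notation "phi →H psi" := (bin ImpH phi psi) (at level 75) : dle_scope.
Notation "phi ←H psi" := (bin PmiH phi psi) (at level 75) : dle_scope.
Notation "phi ≻ psi" := (bin Succ phi psi) (at level 75) : dle_scope.
Notation "phi ≺ psi" := (bin Prec phi psi) (at level 75) : dle_scope.

Inductive residuation (S : dle_sig) :
    sequent (star_sig S) -> sequent (star_sig S) -> Prop :=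
| res_ImpH phi psi chi : residuation (phi ∧ psi ⊢ chi) (psi ⊢ phi →H chi)
| res_PmiH phi psi chi : residuation (phi ∧ psi ⊢ chi) (phi ⊢ chi ←H psi)
| res_Prec phi psi chi : residuation (phi ⊢ psi ∨ chi) (psi ≺ phi ⊢ chi)
| res_Succ phi psi chi : residuation (phi ⊢ psi ∨ chi) (phi ≻ chi ⊢ psi)
| res_F_pos (f : conn S) i a phi psi : isF f -> otype f i = true ->
    residuation (plug (old f) i a phi ⊢ psi) (phi ⊢ plug (adj f i) i a psi)
| res_F_neg (f : conn S) i a phi psi : isF f -> otype f i = false ->
    residuation (plug (old f) i a phi ⊢ psi) (plug (adj f i) i a psi ⊢ phi)
| res_G_pos (g : conn S) j a phi psi : ~~ isF g -> otype g j = true ->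
    residuation (phi ⊢ plug (old g) j a psi) (plug (adj g j) j a phi ⊢ psi)
| res_G_neg (g : conn S) j a phi psi : ~~ isF g -> otype g j = false ->
    residuation (phi ⊢ plug (old g) j a psi) (psi ⊢ plug (adj g j) j a phi).

Definition L_DLE_star (S : dle_sig) : sequent (star_sig S) -> Prop :=
  derivable (@residuation S).

Fixpoint embed (S : dle_sig) (phi : form S) : form (star_sig S) :=
  match phi with
  | Var p => Var p
  | Bot => Bot
  | Top => Top
  | And phi1 phi2 => embed phi1 ∧ embed phi2
  | Or phi1 phi2 => embed phi1 ∨ embed phi2
  | App h a => App (old h) [ffun i => embed (a i)]
  end.

(* Main.v *)
Require Import Defs.
From mathcomp Require Import all_boot.
From mathcomp Require Import boolp classical_sets.

(** Derivations of the minimal logic translate into the expanded logic, since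
    the embedding commutes with substitution and with the application of
    connectives. For the converse, every underivable sequent is refuted in a
    model of the expanded logic.

    The model is a powerset algebra. In a relational frame each connective in F
    is interpreted by an existential, and each one in G by a universal
    quantification over the tuples related to a world. On the full powerset
    these operations preserve (or reverse) all joins or meets required by the
    order-types, so their residuals exist and are given by the same relations
    with the world and one argument exchanged; the residuals of conjunction and
    disjunction are Boolean implication and difference. Since the expanded logic
    does not require the elements of the model to be up-sets, no order on the
    worlds is needed. Hence every frame for the original language yields a
    model of the expanded logic ([star_soundness]).

    The frame used consists of the prime filters of the minimal logic, with the
    relations of the canonical extension. The truth lemma ([truth]) says that
    an embedded formula denotes the set of prime filters that contain it. It
    rests on [existence], which produces the related tuple of prime filters one
    coordinate at a time from the prime filter theorem, itself an application
    of Zorn's lemma. A sequent of the original language that is derivable in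
    the expanded logic is thus preserved by all prime filters, and then it is
    derivable in the minimal logic ([separation]). *)

Set Implicit Arguments.
Unset Strict Implicit.
Unset Printing Implicit Defensive.

Local Open Scope dle_scope.

(** * Formulas *)

(** Structural induction, with hypotheses for the arguments of a connective. *)
Lemma form_ffun_ind (S : dle_sig) (P : form S -> Prop) :
  (forall p, P (Var p)) -> P Bot -> P Top ->
  (forall phi psi, P phi -> P psi -> P (phi ∧ psi)) ->
  (forall phi psi, P phi -> P psi -> P (phi ∨ psi)) ->
  (forall h (a : {ffun 'I_(arity h) -> form S}),
      (forall i, P (a i)) -> P (App h a)) ->
  forall phi, P phi.
Proof.
move=> PV PB PT PA PO PApp; fix IH 1; case.
- exact: PV.
- exact: PB.
- exact: PT.
- by move=> phi psi; apply: PA; apply: IH.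
- by move=> phi psi; apply: PO; apply: IH.
- by move=> h a; apply: PApp => i; apply: IH.
Qed.

Lemma subst_plug (S : dle_sig) (s : nat -> form S) h i a phi :
  subst s (plug h i a phi) = plug h i [ffun j => subst s (a j)] (subst s phi).
Proof.
by congr (App h _); apply/ffunP => j; rewrite !ffunE; case: eqP.
Qed.

Lemma subst_or (S : dle_sig) (s : nat -> form S) phi psi :
  subst s (phi ∨ psi) = (subst s phi ∨ subst s psi).
Proof. by []. Qed.

Lemma subst_and (S : dle_sig) (s : nat -> form S) phi psi :
  subst s (phi ∧ psi) = (subst s phi ∧ subst s psi).
Proof. by []. Qed.

Lemma embed_plug (S : dle_sig) (h : conn S) i a (phi : form S) :
  embed (plug h i a phi) = plug (old h) i [ffun j => embed (a j)] (embed phi).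
Proof.
by congr (App (old h) _); apply/ffunP => j; rewrite !ffunE; case: eqP.
Qed.

Lemma embed_subst (S : dle_sig) (s : nat -> form S) (phi : form S) :
  embed (subst s phi) = subst (@embed S \o s) (embed phi).
Proof.
elim/form_ffun_ind: phi => //= [phi psi -> -> //|phi psi -> -> //|h a IH].
by congr (App (old h) _); apply/ffunP => j; rewrite !ffunE.
Qed.

Lemma embed_or (S : dle_sig) (phi psi : form S) :
  embed (phi ∨ psi) = (embed phi ∨ embed psi).
Proof. by []. Qed.

Lemma embed_and (S : dle_sig) (phi psi : form S) :
  embed (phi ∧ psi) = (embed phi ∧ embed psi).
Proof. by []. Qed.

Lemma derivable_embed (S : dle_sig) (t : sequent S) :
  L_DLE t -> L_DLE_star (embed t.1 ⊢ embed t.2).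
Proof.
rewrite /L_DLE /L_DLE_star.
elim=> {t}; cbn [fst snd].
all: try by intros; constructor.
all: try by intros; rewrite ?embed_plug; constructor.
all: try by intros; rewrite ?(embed_or, embed_and) !embed_plug; constructor.
- by move=> phi chi psi _ H1 _ H2; apply: rule_cut H1 H2.
- by move=> s phi psi _ H; rewrite !embed_subst; apply: rule_subst.
- by [].
- by [].
Qed.

(** * Derived rules of the minimal logic *)

Section Derived.
Variables (S : dle_sig) (R : sequent S -> sequent S -> Prop).
Implicit Types phi psi chi : form S.

Local Notation der phi psi := (derivable R (phi ⊢ psi)).

Definition inst3 phi psi chi (n : nat) : form S :=
  match n with 0 => phi | 1 => psi | _ => chi end.

Lemma der_refl phi : der phi phi.
Proof. exact: (rule_subst (fun=> phi) (ax_id R 0)). Qed.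

Lemma der_bot phi : der Bot phi.
Proof. exact: (rule_subst (fun=> phi) (ax_bot R 0)). Qed.

Lemma der_top phi : der phi Top.
Proof. exact: (rule_subst (fun=> phi) (ax_top R 0)). Qed.

Lemma der_distr phi psi chi :
  der (phi ∧ (psi ∨ chi)) ((phi ∧ psi) ∨ (phi ∧ chi)).
Proof. exact: (rule_subst (inst3 phi psi chi) (ax_distr R 0 1 2)). Qed.

Lemma der_orl phi psi : der phi (phi ∨ psi).
Proof. exact: (rule_subst (inst3 phi psi Top) (ax_orl R 0 1)). Qed.

Lemma der_orr phi psi : der psi (phi ∨ psi).
Proof. exact: (rule_subst (inst3 phi psi Top) (ax_orr R 0 1)). Qed.

Lemma der_andl phi psi : der (phi ∧ psi) phi.
Proof. exact: (rule_subst (inst3 phi psi Top) (ax_andl R 0 1)). Qed.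

Lemma der_andr phi psi : der (phi ∧ psi) psi.
Proof. exact: (rule_subst (inst3 phi psi Top) (ax_andr R 0 1)). Qed.

(** Substituting [phi] and [psi] for two variables of an axiom must not affect
    its parameters; so the axiom is taken with distinct further variables as
    parameters, which are then instantiated by the intended ones. *)
Definition inst_params n (a : {ffun 'I_n -> form S}) phi psi (m : nat) :
    form S :=
  match m with
  | 0 => phi
  | 1 => psi
  | k.+2 => if insub k is Some j then a j else Bot
  end.

Definition var_params n : {ffun 'I_n -> form S} := [ffun j : 'I_n => Var j.+2].

Lemma subst_params h i (a : {ffun 'I_(arity h) -> form S}) phi psi chi :
  subst (inst_params a phi psi) (plug h i (var_params _) chi)
  = plug h i a (subst (inst_params a phi psi) chi).
Proof.
rewrite subst_plug; congr plug.
by apply/ffunP => j; rewrite !ffunE /= valK.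
Qed.

Lemma der_F_or f i a phi psi : isF f -> otype f i = true ->
  der (plug f i a (phi ∨ psi)) (plug f i a phi ∨ plug f i a psi).
Proof.
move=> Ff ei.
have := rule_subst (inst_params a phi psi) (ax_F_or R (var_params _) 0 1 Ff ei).
by rewrite ?(subst_or, subst_and) !subst_params.
Qed.

Lemma der_F_and f i a phi psi : isF f -> otype f i = false ->
  der (plug f i a (phi ∧ psi)) (plug f i a phi ∨ plug f i a psi).
Proof.
move=> Ff ei.
have := rule_subst (inst_params a phi psi) (ax_F_and R (var_params _) 0 1 Ff ei).
by rewrite ?(subst_or, subst_and) !subst_params.
Qed.

Lemma der_G_and g j a phi psi : ~~ isF g -> otype g j = true ->
  der (plug g j a phi ∧ plug g j a psi) (plug g j a (phi ∧ psi)).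
Proof.
move=> Gg ej.
have := rule_subst (inst_params a phi psi) (ax_G_and R (var_params _) 0 1 Gg ej).
by rewrite ?(subst_or, subst_and) !subst_params.
Qed.

Lemma der_G_or g j a phi psi : ~~ isF g -> otype g j = false ->
  der (plug g j a phi ∧ plug g j a psi) (plug g j a (phi ∨ psi)).
Proof.
move=> Gg ej.
have := rule_subst (inst_params a phi psi) (ax_G_or R (var_params _) 0 1 Gg ej).
by rewrite ?(subst_or, subst_and) !subst_params.
Qed.

End Derived.

(** * Relational semantics *)

(** [lit b P] is [P] or its negation, according to the sign [b]. *)
Definition lit (b : bool) (P : Prop) : Prop := if b then P else ~ P.

Lemma lit_iff b P Q : (P <-> Q) -> (lit b P <-> lit b Q).
Proof. by move=> PQ; case: b => //=; rewrite PQ. Qed.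

(** A frame gives each [n]-ary connective an [n+1]-ary relation on worlds. *)
Record frame (S : dle_sig) := Frame {
  world :> Type;
  acc : forall h : conn S, world -> ('I_(arity h) -> world) -> Prop
}.

Arguments acc {S f} h w v.

(** Formulas denote arbitrary sets of worlds, so that the complex algebra is
    the full powerset. Connectives in F are interpreted existentially,
    [f(X) w] iff [w] is related to some [v] with [v i] in [X i] at positive and
    outside [X i] at negative coordinates. Connectives in G are interpreted as
    negations of existential statements, with the signs of all coordinates
    reversed. Both cases are covered by the sign [otype h i == isF h]. *)
Fixpoint sat (S : dle_sig) (M : frame S) (V : nat -> M -> Prop) (phi : form S) :
    M -> Prop :=
  match phi with
  | Var p => V p
  | Bot => fun=> False
  | Top => fun=> True
  | And phi1 phi2 => fun w => sat V phi1 w /\ sat V phi2 w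
  | Or phi1 phi2 => fun w => sat V phi1 w \/ sat V phi2 w
  | App h a => fun w => lit (isF h) (exists2 v, acc h w v &
      forall i, lit (otype h i == isF h) (sat V (a i) (v i)))
  end.

Definition valid (S : dle_sig) (M : frame S) (t : sequent S) : Prop :=
  forall (V : nat -> M -> Prop) w, sat V t.1 w -> sat V t.2 w.

Section Soundness.
Variables (S : dle_sig) (M : frame S).
Implicit Types (V : nat -> M -> Prop) (phi : form S).

(** [sat] at an application [h_i[phi]], with the condition on the
    distinguished coordinate separated from those on the parameters. *)
Lemma sat_plug V h i a phi w : sat V (plug h i a phi) w <->
  lit (isF h) (exists v, [/\ acc h w v,
     forall j, j != i -> lit (otype h j == isF h) (sat V (a j) (v j)) &
     lit (otype h i == isF h) (sat V phi (v i))]).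
Proof.
apply: lit_iff; split=> [[v Rv Hv]|[v [Rv Ha Hi]]]; exists v => //.
  split=> // [j ji|]; last by have := Hv i; rewrite ffunE eqxx.
  by have := Hv j; rewrite ffunE (negPf ji).
by move=> j; rewrite ffunE; case: (eqVneq j i) => [->|]; last exact: Ha.
Qed.

Lemma sat_subst V (s : nat -> form S) phi :
  sat V (subst s phi) = sat (fun p => sat V (s p)) phi.
Proof.
elim/form_ffun_ind: phi => //= [phi psi -> ->|phi psi -> ->|h a IH] //.
apply/funext => w; congr (lit _ (exists2 v, _ & _)); apply/funext => v.
by apply/eq_forall => i; rewrite ffunE IH.
Qed.

(** All axioms and rules of the minimal logic hold in every frame, so only the
    additional rules need to be checked. *)
Lemma soundness (R : sequent S -> sequent S -> Prop) :
  (forall s t, R s t -> valid M s <-> valid M t) ->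
  forall t, derivable R t -> valid M t.
Proof.
move=> validR t; elim=> {t} /=.
- by move=> p V w.
- by move=> p V w.
- by move=> p V w.
- by move=> p q r V w /= [? [?|?]]; [left|right].
- by move=> p q V w /=; left.
- by move=> p q V w /=; right.
- by move=> p q V w /= [].
- by move=> p q V w /= [].
- by move=> f i a Ff ei V w /sat_plug; rewrite Ff ei => -[v []].
- move=> f i a p q Ff ei V w /sat_plug; rewrite Ff ei => -[v [Rv Ha]].
  by case=> H; [left|right]; apply/sat_plug; rewrite Ff ei; exists v.
- by move=> f i a Ff ei V w /sat_plug; rewrite Ff ei => -[v [_ _ /=]]; apply.
- move=> f i a p q Ff ei V w /sat_plug; rewrite Ff ei => -[v [Rv Ha]].
  by move=> /not_andP[] H; [left|right]; apply/sat_plug; rewrite Ff ei; exists v.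
- move=> g j a /negPf Gg ej V w _; apply/sat_plug; rewrite Gg ej => -[v [_ _ /=]].
  exact.
- move=> g j a p q /negPf Gg ej V w [/sat_plug + /sat_plug +].
  rewrite Gg ej => Hp Hq; apply/sat_plug; rewrite Gg ej => -[v [Rv Ha]].
  by move=> /not_andP[] H; [apply: Hp|apply: Hq]; exists v.
- by move=> g j a /negPf Gg ej V w _; apply/sat_plug; rewrite Gg ej => -[v []].
- move=> g j a p q /negPf Gg ej V w [/sat_plug + /sat_plug +].
  rewrite Gg ej => Hp Hq; apply/sat_plug; rewrite Gg ej => -[v [Rv Ha]].
  by case=> H; [apply: Hp|apply: Hq]; exists v.
- by move=> phi chi psi _ H1 _ H2 V w /H1 /H2.
- by move=> s phi psi _ H V w; rewrite !sat_subst; apply: H.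
- by move=> chi phi psi _ H1 _ H2 V w Hw; split; [apply: H1|apply: H2].
- by move=> phi psi chi _ H1 _ H2 V w [/H1|/H2].
- move=> h i a phi psi ei _ H V w /sat_plug Hw; apply/sat_plug; move: Hw.
  rewrite ei; case: (isF h) => /=.
    by case=> v [Rv Ha /H Hi]; exists v.
  by apply: contra_not => -[v [Rv Ha Hi]]; exists v; split=> // /H.
- move=> h i a phi psi ei _ H V w /sat_plug Hw; apply/sat_plug; move: Hw.
  rewrite ei; case: (isF h) => /=.
    by case=> v [Rv Ha Hi]; exists v; split=> // /H.
  by apply: contra_not => -[v [Rv Ha /H Hi]]; exists v.
- by move=> s t /validR ->.
- by move=> s t /validR <-.
Qed.

End Soundness.

(** * Frames for the expanded language *)

(** The tuple [v] with its [i]-th entry replaced by [x]. *)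
Definition upd (T : Type) n (i : 'I_n) (v : 'I_n -> T) (x : T) (j : 'I_n) : T :=
  if j == i then x else v j.

Lemma upd_eq T n i (v : 'I_n -> T) x : upd i v x i = x.
Proof. by rewrite /upd eqxx. Qed.

Lemma upd_neq T n i (v : 'I_n -> T) x j : j != i -> upd i v x j = v j.
Proof. by rewrite /upd => /negPf ->. Qed.

Lemma updK T n i (v : 'I_n -> T) x : upd i (upd i v x) (v i) = v.
Proof. by apply/funext => j; rewrite /upd; case: eqP => [->|]. Qed.

(** The relation of an adjoint in coordinate [i] is that of the
    original connective with the world and the [i]-th argument exchanged. The
    lattice residuals are interpreted through the identity relation, that is, as
    the Boolean implications and differences of the powerset. *)
Definition star_acc (S : dle_sig) (M : frame S) (c : star_conn S) :
    M -> ('I_(star_arity c) -> M) -> Prop :=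
  match c return M -> ('I_(star_arity c) -> M) -> Prop with
  | Old h => fun w v => acc h w v
  | Lat l => fun w v => forall i, v i = w
  | Adj h i => fun w v => acc h (v i) (upd i v w)
  end.

Definition star_frame (S : dle_sig) (M : frame S) : frame (star_sig S) :=
  @Frame (star_sig S) M (@star_acc S M).

Section StarSoundness.
Variables (S : dle_sig) (M : frame S).
Implicit Types (V : nat -> star_frame M -> Prop) (phi : form (star_sig S)).

Lemma sat_bin V l phi psi w : sat V (bin l phi psi) w <->
  match l with
  | ImpH => sat V phi w -> sat V psi w
  | PmiH => sat V psi w -> sat V phi w
  | Succ => sat V phi w /\ ~ sat V psi w
  | Prec => ~ sat V phi w /\ sat V psi w
  end.
Proof.
have bin_exists (b0 b1 : bool) (e : 'I_2 -> bool) :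
  e ord0 = b0 -> e ord_max = b1 ->
  (exists2 v : 'I_2 -> star_frame M, (forall i, v i = w) &
     forall i : 'I_2, lit (e i)
       (sat V ([ffun i : 'I_2 => if i == 0 :> nat then phi else psi] i) (v i)))
  <-> lit b0 (sat V phi w) /\ lit b1 (sat V psi w).
  move=> <- <-; split=> [[v vw Hv]|[H0 H1]].
    by have := Hv ord0; have := Hv ord_max; rewrite !ffunE !vw.
  exists (fun=> w) => // -[[|[|//]] lti]; rewrite ffunE /=.
    by rewrite (_ : Ordinal lti = ord0) //; apply: val_inj.
  by rewrite (_ : Ordinal lti = ord_max) //; apply: val_inj.
case: l => /=.
- rewrite (bin_exists true false) //=; split=> [H Hp|H [Hp]].
    by apply: contrapT => Hq; apply: H.
  by apply; apply: H.
- rewrite (bin_exists false true) //=; split=> [H Hp|H [Hp Hq]].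
    by apply: contrapT => Hq; apply: H.
  by apply: Hp; apply: H.
- by rewrite (bin_exists true false).
- by rewrite (bin_exists false true).
Qed.

(** The clause for an adjoint, in terms of the relation and the signs of [h]. *)
Lemma sat_adj V (h : conn S) (i : 'I_(arity h)) a phi w :
  sat V (plug (adj h i) i a phi) w <->
  lit (isF h != otype h i) (exists u v, [/\ acc h u v, v i = w,
     forall j, j != i -> lit (otype h j == isF h) (sat V (a j) (v j)) &
     lit (~~ isF h) (sat V phi u)]).
Proof.
rewrite sat_plug /= eqxx.
have -> : (if otype h i then ~~ isF h else isF h) = (isF h != otype h i).
  by case: (otype h i); case: (isF h).
apply: lit_iff; split=> [[v [Rv Ha Hi]]|[u [v [Rv vi Ha Hu]]]].
  exists (v i), (upd i v w); split=> //; first exact: upd_eq.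
    move=> j ji; rewrite upd_neq //; move: (Ha j ji); rewrite (negPf ji).
    by case: (otype h i) (isF h) (otype h j) => [] [] [].
  by move: Hi; case: (otype h i) (isF h) => [] [].
exists (upd i v u); rewrite upd_eq -vi updK; split=> //.
  move=> j ji; rewrite upd_neq //; move: (Ha j ji); rewrite (negPf ji).
  by case: (otype h i) (isF h) (otype h j) => [] [] [].
by move: Hu; case: (otype h i) (isF h) => [] [].
Qed.

Lemma sat_old V (h : conn S) i a phi w : sat V (plug (old h) i a phi) w <->
  lit (isF h) (exists v, [/\ acc h w v,
     forall j, j != i -> lit (otype h j == isF h) (sat V (a j) (v j)) &
     lit (otype h i == isF h) (sat V phi (v i))]).
Proof. exact: sat_plug. Qed.

(** For a connective [h], both sequents of a rule say that no world and tuple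
    related by [h] satisfy the signed conditions on the parameters, on the
    [i]-th argument and on the world; they only differ in which of the last two
    is the world of evaluation. *)
Lemma residuation_valid s t :
  residuation s t -> valid (star_frame M) s <-> valid (star_frame M) t.
Proof.
case=> {s t}.
- move=> phi psi chi; split=> H V w.
    by move=> Hw; apply/sat_bin => Hp; apply: H.
  by case=> Hp /H /sat_bin; apply.
- move=> phi psi chi; split=> H V w.
    by move=> Hw; apply/sat_bin => Hp; apply: H.
  by case=> /H /sat_bin Hp; apply: Hp.
- move=> phi psi chi; split=> H V w.
    by case/sat_bin => Hp /H [].
  move=> Hw; case: (EM (sat V psi w)); [by left|move=> Hp; right].
  by apply: H; apply/sat_bin.
- move=> phi psi chi; split=> H V w.
    by case/sat_bin => /H [].
  move=> Hw; case: (EM (sat V chi w)); [by right|move=> Hp; left].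
  by apply: H; apply/sat_bin.
- move=> f i a phi psi Ff ei; split=> H V w.
    move=> Hw; apply/sat_adj; rewrite Ff ei => -[u [v [Rv vi Ha]]]; apply.
    by apply: H; apply/sat_old; rewrite Ff ei; exists v; rewrite -vi in Hw.
  move/sat_old; rewrite Ff ei => -[v [Rv Ha /H /sat_adj]].
  rewrite Ff ei => Hn; apply: contrapT => Hw; apply: Hn.
  by exists w, v.
- move=> f i a phi psi Ff ei; split=> H V w.
    move/sat_adj; rewrite Ff ei => -[u [v [Rv vi Ha Hu]]].
    apply: contrapT => Hw; apply: Hu; apply: H; apply/sat_old; rewrite Ff ei.
    by exists v; split=> //; rewrite vi.
  move/sat_old; rewrite Ff ei => -[v [Rv Ha Hi]].
  apply: contrapT => Hw; apply: Hi; apply: H; apply/sat_adj; rewrite Ff ei.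
  by exists w, v.
- move=> g i a phi psi /negPf Gg ei; split=> H V w.
    move/sat_adj; rewrite Gg ei => -[u [v [Rv vi Ha /H /sat_old]]].
    rewrite Gg ei => Hn; apply: contrapT => Hw; apply: Hn.
    by exists v; split=> //; rewrite vi.
  move=> Hw; apply/sat_old; rewrite Gg ei => -[v [Rv Ha]]; apply.
  by apply: H; apply/sat_adj; rewrite Gg ei; exists w, v.
- move=> g i a phi psi /negPf Gg ei; split=> H V w.
    move=> Hw; apply/sat_adj; rewrite Gg ei => -[u [v [Rv vi Ha /H /sat_old]]].
    by rewrite Gg ei; apply; exists v; rewrite -vi in Hw.
  move=> Hw; apply/sat_old; rewrite Gg ei => -[v [Rv Ha /H /sat_adj]].
  by rewrite Gg ei; apply; exists w, v.
Qed.

Lemma star_soundness t : L_DLE_star t -> valid (star_frame M) t.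
Proof. by apply: soundness => {}t; apply: residuation_valid. Qed.

End StarSoundness.

(** * Prime filters *)

Section PrimeFilters.
Variable S : dle_sig.
Implicit Types phi psi chi : form S.

Local Notation der phi psi := (@L_DLE S (phi ⊢ psi)).

(** The operations of the Lindenbaum lattice, or of its order-dual when the
    sign [b] is negative. *)
Definition sder b phi psi : Prop := if b then der phi psi else der psi phi.
Definition stop b : form S := if b then Top else Bot.
Definition smeet b phi psi : form S := if b then phi ∧ psi else phi ∨ psi.

(** Filters for a positive, ideals for a negative sign; not necessarily
    proper. *)
Record sfilter (b : bool) (F : form S -> Prop) : Prop := SFilter {
  sfilter_top : F (stop b);
  sfilter_up : forall phi psi, sder b phi psi -> F phi -> F psi;
  sfilter_meet : forall phi psi, F phi -> F psi -> F (smeet b phi psi)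
}.

(** Prime filters of the Lindenbaum lattice, as sets of formulas. *)
Record prime (w : form S -> Prop) : Prop := Prime {
  prime_filter : sfilter true w;
  prime_bot : ~ w Bot;
  prime_or : forall phi psi, w (phi ∨ psi) -> w phi \/ w psi
}.

Definition point : Type := {w : form S -> Prop | prime w}.

Definition mem_point (w : point) phi : Prop := sval w phi.
Local Coercion mem_point : point >-> Funclass.

Lemma point_up (w : point) phi psi : der phi psi -> w phi -> w psi.
Proof. exact: (sfilter_up (prime_filter (svalP w))). Qed.

Lemma point_top (w : point) : w Top.
Proof. exact: (sfilter_top (prime_filter (svalP w))). Qed.

Lemma point_bot (w : point) : ~ w Bot.
Proof. exact: (prime_bot (svalP w)). Qed.

Lemma point_and (w : point) phi psi : w (phi ∧ psi) <-> w phi /\ w psi.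
Proof.
split=> [H|[]]; last exact: (sfilter_meet (prime_filter (svalP w))).
by split; apply: point_up H; [apply: der_andl|apply: der_andr].
Qed.

Lemma point_or (w : point) phi psi : w (phi ∨ psi) <-> w phi \/ w psi.
Proof.
split; first exact: (prime_or (svalP w)).
by case=> H;
  [apply: point_up (der_orl _ _ _) H|apply: point_up (der_orr _ _ _) H].
Qed.

Lemma sder_refl b phi : sder b phi phi.
Proof. by case: b; apply: der_refl. Qed.

Lemma sder_trans b phi chi psi :
  sder b phi chi -> sder b chi psi -> sder b phi psi.
Proof. by case: b => /= H1 H2; [apply: rule_cut H1 H2|apply: rule_cut H2 H1]. Qed.

Lemma sder_top b phi : sder b phi (stop b).
Proof. by case: b; [apply: der_top|apply: der_bot]. Qed.

Lemma sder_meetl b phi psi : sder b (smeet b phi psi) phi.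
Proof. by case: b; [apply: der_andl|apply: der_orl]. Qed.

Lemma sder_meetr b phi psi : sder b (smeet b phi psi) psi.
Proof. by case: b; [apply: der_andr|apply: der_orr]. Qed.

Lemma sder_meet b chi phi psi :
  sder b chi phi -> sder b chi psi -> sder b chi (smeet b phi psi).
Proof. by case: b => /= H1 H2; [apply: rule_and|apply: rule_or]. Qed.

Lemma sderN b phi psi : sder (~~ b) phi psi = sder b psi phi.
Proof. by case: b. Qed.

Lemma principal_sfilter b phi : sfilter b (sder b phi).
Proof.
split; [exact: sder_top| |exact: sder_meet].
by move=> psi chi H1 H2; apply: sder_trans H2 H1.
Qed.

Lemma point_sfilter b (w : point) : sfilter b (fun phi => lit b (w phi)).
Proof.
case: b => /=; first exact: prime_filter (svalP w).
split=> [|phi psi /= H|phi psi Hp Hq /=]; first exact: point_bot.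
  by apply: contra_not; apply: point_up.
by move/point_or => [].
Qed.

(** The filter generated by a filter and one more formula. *)
Lemma adjoin_sfilter (F : form S -> Prop) phi :
  sfilter true F ->
  sfilter true (fun psi => exists2 m, F m & der (m ∧ phi) psi).
Proof.
move=> [Ftop Fup Fmeet]; split.
- by exists Top => //; apply: der_top.
- by move=> psi chi H [m Fm Hm]; exists m => //; apply: rule_cut Hm H.
- move=> psi chi [m Fm Hm] [n Fn Hn]; exists (m ∧ n); first exact: Fmeet.
  apply: rule_and; [apply: rule_cut Hm|apply: rule_cut Hn].
    apply: rule_and; last exact: der_andr.
    by apply: rule_cut (der_andl _ _ _); apply: der_andl.
  apply: rule_and; last exact: der_andr.
  by apply: rule_cut (der_andr _ m n); apply: der_andl.
Qed.

Lemma prime_filter_theorem (F I : form S -> Prop) :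
  sfilter true F -> sfilter false I -> (forall phi, F phi -> I phi -> False) ->
  exists w : point,
    (forall phi, F phi -> w phi) /\ (forall phi, I phi -> ~ w phi).
Proof.
move=> filF idlI FI.
pose good X := sfilter true X /\ forall phi, X phi -> I phi -> False.
(* Maximizing over sets joined with [F] makes the empty chain harmless. *)
have [A [[filM MI] Amax]] : exists A : set (form S), good (A `|` F)%classic /\
    forall B : set (form S), (A `<` B)%classic -> ~ good (B `|` F)%classic.
  apply: (@Zorn_bigcup (form S) (fun A => good (A `|` F)%classic)).
  move=> C Cgood Ctot.
  split; last first.
    move=> phi [[X CX Xphi]|]; last exact: FI.
    by apply: (Cgood X CX).2; left.
  split.
  - by right; apply: sfilter_top filF.
  - move=> phi psi H [[X CX Xphi]|Fphi]; last by right; apply: sfilter_up H Fphi.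
    have [] := sfilter_up (Cgood X CX).1 H (or_introl Xphi); last by right.
    by move=> Xpsi; left; exists X.
  - have sub X : C X -> (forall phi, (X `|` F)%classic phi ->
        ((\bigcup_(X in C) X) `|` F)%classic phi).
      by move=> CX phi [Xphi|]; [left; exists X|right].
    move=> phi psi [[X CX Xphi]|Fphi] [[Y CY Ypsi]|Fpsi].
    + have [XY|YX] := Ctot X Y CX CY.
        apply: (sub Y CY); apply: (sfilter_meet (Cgood Y CY).1); left => //.
        exact: XY.
      apply: (sub X CX); apply: (sfilter_meet (Cgood X CX).1); left => //.
      exact: YX.
    + by apply: (sub X CX); apply: (sfilter_meet (Cgood X CX).1); [left|right].
    + by apply: (sub Y CY); apply: (sfilter_meet (Cgood Y CY).1); [right|left].
    + by right; apply: (sfilter_meet filF).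
set M := (A `|` F)%classic in filM MI.
have Mmax phi : ~ M phi -> exists2 m, M m & I (m ∧ phi).
  move=> nMphi; apply: contrapT => noI.
  pose B : set (form S) := fun psi => exists2 m, M m & der (m ∧ phi) psi.
  have MB psi : M psi -> B psi by move=> Mpsi; exists psi => //; apply: der_andl.
  have filB : sfilter true B by exact: adjoin_sfilter.
  have Bphi : B phi by exists Top; [exact: sfilter_top filM|apply: der_andr].
  apply: (Amax B).
    split; first by move=> psi Apsi; apply: MB; left.
    by move=> BA; apply: nMphi; left; apply: BA.
  have -> : (B `|` F)%classic = B.
    by apply/seteqP; split=> psi; [case=> // Fpsi; apply: MB; right|left].
  split=> // psi [m Mm Hm] Ipsi; apply: noI; exists m => //.
  exact: sfilter_up idlI _ _ Hm Ipsi.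
have primeM : prime M.
  split=> //.
    by move=> MBot; apply: (MI Bot) => //; apply: sfilter_top idlI.
  move=> phi psi Mor; apply: contrapT => /not_orP[/Mmax[m Mm Im] /Mmax[n Mn In]].
  apply: (MI ((m ∧ n) ∧ (phi ∨ psi))).
    by do 2![apply: (sfilter_meet filM) => //].
  apply: (sfilter_up idlI) (sfilter_meet idlI Im In) => /=.
  apply: rule_cut (der_distr _ _ _ _) _.
  apply: rule_or.
    apply: rule_cut (der_orl _ _ _); apply: rule_and; last exact: der_andr.
    by apply: rule_cut (der_andl _ m n); apply: der_andl.
  apply: rule_cut (der_orr _ _ _); apply: rule_and; last exact: der_andr.
  by apply: rule_cut (der_andr _ m n); apply: der_andl.
exists (exist _ M primeM); split=> phi; first by right.
by move=> Iphi Mphi; apply: (MI phi).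
Qed.

(** For the negative sign, the point separates with the roles of filter and
    ideal exchanged. *)
Lemma signed_prime_filter_theorem b (F I : form S -> Prop) :
  sfilter b F -> sfilter (~~ b) I -> (forall phi, F phi -> I phi -> False) ->
  exists w : point,
    (forall phi, F phi -> lit b (w phi)) /\
    (forall phi, I phi -> ~ lit b (w phi)).
Proof.
case: b => /= [|filF filI FI]; first exact: prime_filter_theorem.
have [||phi Iphi Fphi|w [Iw Fw]] := @prime_filter_theorem I F => //.
  exact: (FI phi).
by exists w; split=> [//|phi /Iw wphi]; apply.
Qed.

(** * The canonical frame *)

(** [App h a] belongs to [w] if [h] is in F, and does not if [h] is in G. As a
    condition on [a], this is monotone, and preserves finite joins, in each
    coordinate, when coordinate [i] carries the derivability order or its dual
    according to [csign i]; see [smem_up], [smem_prime] and [smem_bot]. *)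
Definition smem (w : point) (h : conn S) (a : {ffun 'I_(arity h) -> form S}) :
    Prop :=
  lit (isF h) (w (App h a)).

(** The sign in the semantic clause for [h]. *)
Definition csign (h : conn S) (i : 'I_(arity h)) : bool := otype h i == isF h.

(** The arguments of [plug h i a phi]. *)
Definition fupd (h : conn S) (i : 'I_(arity h))
    (a : {ffun 'I_(arity h) -> form S}) phi :=
  [ffun j => if j == i then phi else a j].

Lemma fupd_id (h : conn S) (i : 'I_(arity h)) (a : {ffun _ -> form S}) :
  fupd i a (a i) = a.
Proof. by apply/ffunP => j; rewrite ffunE; case: eqP => [->|]. Qed.

Lemma smem_up w (h : conn S) (i : 'I_(arity h)) a phi psi :
  sder (csign i) phi psi ->
  smem w (fupd i a phi) -> smem w (fupd i a psi).
Proof.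
rewrite /smem /csign; case Fh: (isF h); case ei: (otype h i) => /= H.
- by apply: point_up; apply: rule_mono.
- by apply: point_up; apply: rule_anti.
- by apply: contra_not; apply: point_up; apply: rule_mono.
- by apply: contra_not; apply: point_up; apply: rule_anti.
Qed.

Lemma smem_prime w (h : conn S) (i : 'I_(arity h)) a phi psi :
  smem w (fupd i a (smeet (~~ csign i) phi psi)) ->
  smem w (fupd i a phi) \/ smem w (fupd i a psi).
Proof.
rewrite /smem /csign; case Fh: (isF h); case ei: (otype h i) => /=.
- by move=> H; apply/point_or; apply: point_up H; apply: der_F_or.
- by move=> H; apply/point_or; apply: point_up H; apply: der_F_and.
- move=> H; apply/not_andP; apply: contra_not H => /point_and.
  by apply: point_up; apply: der_G_and => //; rewrite Fh.
- move=> H; apply/not_andP; apply: contra_not H => /point_and.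
  by apply: point_up; apply: der_G_or => //; rewrite Fh.
Qed.

Lemma smem_bot w (h : conn S) (i : 'I_(arity h)) a :
  ~ smem w (fupd i a (stop (~~ csign i))).
Proof.
rewrite /smem /csign; case Fh: (isF h); case ei: (otype h i) => /= H.
- by apply: (@point_bot w); apply: point_up H; apply: ax_F_bot.
- by apply: (@point_bot w); apply: point_up H; apply: ax_F_top.
- by apply: H; apply: point_up (point_top w); apply: ax_G_top => //; rewrite Fh.
- by apply: H; apply: point_up (point_top w); apply: ax_G_bot => //; rewrite Fh.
Qed.

(** The arguments are replaced one coordinate at a time. *)
Lemma smem_up_all w (h : conn S) (a a' : {ffun 'I_(arity h) -> form S}) :
  (forall i, sder (csign i) (a i) (a' i)) -> smem w a -> smem w a'.
Proof.
move=> aa' wa.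
have -> : a' = [ffun i => if i \in enum 'I_(arity h) then a' i else a i].
  by apply/ffunP => i; rewrite ffunE mem_enum.
elim: (enum _) => [|i s IH].
  by congr (smem w _): wa; apply/ffunP => i; rewrite ffunE.
set c := [ffun j => _] in IH.
have -> : [ffun j => if j \in i :: s then a' j else a j] = fupd i c (a' i).
  by apply/ffunP => j; rewrite !ffunE in_cons; case: (eqVneq j i) => [->|].
apply: (@smem_up _ _ _ _ (c i)); last by rewrite fupd_id.
by rewrite ffunE; case: ifP => // _; apply: sder_refl.
Qed.

(** In the canonical frame [h] relates [w] to [v] when every tuple [a] whose
    components belong to the components of [v], up to the signs [csign], yields
    a formula [h(a)] that belongs to [w], up to the sign of [h]. *)
Definition canonical_acc (h : conn S) (w : point)
    (v : 'I_(arity h) -> point) : Prop :=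
  forall a : {ffun 'I_(arity h) -> form S},
    (forall i, lit (csign i) (v i (a i))) -> smem w a.

Definition canonical : frame S := Frame canonical_acc.

(** Prime filters are chosen one coordinate at a time, those not yet chosen
    being replaced by the principal filters of the given formulas. *)
Lemma existence w (h : conn S) (a : {ffun 'I_(arity h) -> form S}) : smem w a ->
  exists2 v, canonical_acc w v & forall i, lit (csign i) (v i (a i)).
Proof.
move=> wa.
pose U (v : 'I_(arity h) -> point) (s : seq 'I_(arity h)) i phi :=
  if i \in s then lit (csign i) (v i phi) else sder (csign i) (a i) phi.
have filU v s i : sfilter (csign i) (U v s i).
  by rewrite /U; case: (i \in s); [apply: point_sfilter|apply: principal_sfilter].
suff [v [vacc va]] : exists v, (forall c : {ffun _ -> form S},
    (forall i, U v (enum 'I_(arity h)) i (c i)) -> smem w c) /\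
    forall i, U v (enum 'I_(arity h)) i (a i).
  have UE i : U v (enum 'I_(arity h)) i = fun phi => lit (csign i) (v i phi).
    by apply/funext => phi; rewrite /U mem_enum.
  exists v => [c vc|i]; first by apply: vacc => i; rewrite UE.
  by have := va i; rewrite UE.
elim: (enum _) => [|i s [v [vacc va]]].
  exists (fun=> w); split=> [c|i]; rewrite /U /=; last exact: sder_refl.
  by move=> ac; apply: smem_up_all wa.
case: (boolP (i \in s)) => [is_|is_].
  exists v; have UE j : U v (i :: s) j = U v s j.
    by rewrite /U in_cons; case: eqP => [->|//]; rewrite is_.
  by split=> [c vc|j]; [apply: vacc => j; rewrite -UE|rewrite UE].
(* A signed prime filter containing [U v s i] can be chosen for [v i] if it
   avoids [I], the formulas that some tuple from the other coordinates takes
   outside [smem w]. *)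
pose I phi := exists2 c : {ffun _ -> form S},
  (forall j, j != i -> U v s j (c j)) & ~ smem w (fupd i c phi).
have filI : sfilter (~~ csign i) I.
  split.
  - by exists a => [j _|]; [apply: va|apply: smem_bot].
  - move=> phi psi; rewrite sderN => le [c vc wc]; exists c => //.
    by apply: contra_not wc; apply: smem_up.
  - move=> phi psi [c vc wc] [d vd wd].
    (* Both parameter tuples are replaced by their coordinatewise meet. *)
    pose e := [ffun j => smeet (csign j) (c j) (d j)].
    exists e => [j ji|/smem_prime[]].
    + by rewrite ffunE; apply: (sfilter_meet (filU v s j)); [apply: vc|apply: vd].
    + apply: contra_not wc; apply: smem_up_all => j; rewrite !ffunE.
      by case: ifP => _; [apply: sder_refl|apply: sder_meetl].
    + apply: contra_not wd; apply: smem_up_all => j; rewrite !ffunE.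
      by case: ifP => _; [apply: sder_refl|apply: sder_meetr].
have UI phi : U v s i phi -> I phi -> False.
  move=> vphi [c vc]; apply; apply: vacc => j; rewrite ffunE.
  by case: (eqVneq j i) => [->|/vc].
have [u [Uu Iu]] := signed_prime_filter_theorem (filU v s i) filI UI.
exists (upd i v u).
have Ui : U (upd i v u) (i :: s) i = fun phi => lit (csign i) (u phi).
  by apply/funext => phi; rewrite /U mem_head upd_eq.
have Uj j : j != i -> U (upd i v u) (i :: s) j = U v s j.
  by move=> ji; apply/funext => phi; rewrite /U in_cons (negPf ji) upd_neq.
split=> [c vc|j]; last first.
  by case: (eqVneq j i) => [->|ji]; [rewrite Ui; apply: Uu|rewrite Uj].
apply: contrapT => wc; have := vc i; rewrite Ui; apply: Iu; exists c.
  by move=> j ji; rewrite -Uj.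
by rewrite fupd_id.
Qed.

(** Under the valuation sending a variable to the prime filters containing it,
    a formula of the original language denotes the set of prime filters
    containing it. *)
Lemma truth phi (w : point) :
  sat (M := star_frame canonical) (fun p (w : point) => w (Var p)) (embed phi) w
  <-> w phi.
Proof.
elim/form_ffun_ind: phi w =>
  /= [p w|w|w|phi psi IHp IHq w|phi psi IHp IHq w|h a IH w].
- by [].
- by split=> // /point_bot.
- by split=> // _; apply: point_top.
- by rewrite IHp IHq point_and.
- by rewrite IHp IHq point_or.
have signed P : (P <-> smem w a) -> (lit (isF h) P <-> w (App h a)).
  by rewrite /smem; case: (isF h) => //= ->; split=> [/contrapT|? ?].
apply: signed; split=> [[v Rv Hv]|/existence[v Rv Hv]].
  apply: Rv => i; have := Hv i; rewrite ffunE.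
  by move/(lit_iff _ (IH i (v i))).
exists v => // i; rewrite ffunE.
by apply/(lit_iff _ (IH i (v i))); apply: Hv.
Qed.

Lemma separation phi psi : (forall w : point, w phi -> w psi) -> der phi psi.
Proof.
move=> Hw; apply: contrapT => nder.
have [chi /= H1 H2|w [Hp Hq]] := prime_filter_theorem
  (principal_sfilter true phi) (principal_sfilter false psi).
  by apply: nder; apply: rule_cut H1 H2.
by apply: (Hq psi (sder_refl false psi)); apply: Hw; apply: Hp; apply: sder_refl.
Qed.

End PrimeFilters.

(** * Conservativity *)

Theorem theorem4 (S : dle_sig) (phi psi : form S) :
  L_DLE (phi ⊢ psi) <-> L_DLE_star (embed phi ⊢ embed psi).
Proof.
split=> [|/(@star_soundness _ (canonical S)) H]; first exact: derivable_embed.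
by apply: separation => w /truth wphi; apply/truth; apply: H wphi.
Qed.
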